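(* Let $\chi\in C([0,1];[0,1])$ be the Cantor--Lebesgue--Vitali function (the Cantor staircase), and let $\lambda,\gamma>0$, $p\in[1,\infty]$. If $$\gamma > \left(\frac1p\cdot\frac{\log 3}{\log 2}+1\right)^{-1},$$ then $\chi$ is not a minimizer of the functional $$F(u) = \mathrm{TV}(u) + \lambda\|u-\chi\|_p^\gamma$$ among functions $u$ of bounded variation on $[0,1]$.
   Context: For a function $u:I\to\mathbb{R}$ on an interval $I$, $\mathrm{TV}(u)=\mathrm{TV}(u;I)$ is the pointwise total variation, i.e. the supremum of $\sum_{i=1}^n|u(x_i)-u(x_{i-1})|$ over all finite sequences $x_0\le x_1\le\dots\le x_n$ of points of $I$; $u$ has bounded variation if $\mathrm{TV}(u;I)<\infty$. Here $I=[0,1]$. $\|\cdot\|_p$ is the $L^p$ norm on $I$. When $p=\infty$, $1/p$ is interpreted as $0$. *)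

(* Defs.v *)
From HB Require Import structures.
From mathcomp Require Import all_boot all_order all_algebra.
From mathcomp Require Import all_classical all_reals all_analysis.

Set Implicit Arguments.
Unset Strict Implicit.
Unset Printing Implicit Defensive.

Import Order.TTheory GRing.Theory Num.Theory.
Import numFieldNormedType.Exports.

Local Open Scope classical_set_scope.
Local Open Scope ring_scope.

(* Functions on [0, 1] are represented by total functions R -> R of which only
   the values on [0, 1] are relevant. *)

(* The usual piecewise affine approximations of the Cantor function: each step
   puts a half-size copy of the graph over [0, 1/3] and over [2/3, 1], with a
   plateau at height 1/2 in between. *)
Fixpoint staircase (R : realType) (n : nat) (x : R) : R :=
  if n is m.+1 then
    if x <= 1 / 3 then staircase m (3 * x) / 2
    else if x < 2 / 3 then 1 / 2
    else (1 + staircase m (3 * x - 2)) / 2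
  else x.

(* The sequence converges uniformly on [0, 1]; it diverges outside, where the
   value of lim carries no meaning. *)
Definition cantor_function (R : realType) (x : R) : R :=
  lim (staircase n x @[n --> \oo]).

Definition Lnorm01 (R : realType) (p : \bar R) (f : R -> R) : \bar R :=
  Lnorm (@lebesgue_measure R) p ((EFin \o f) \_ `[0, 1]).

Definition TVfidelity (R : realType) (lambda gamma : R) (p : \bar R)
    (g u : R -> R) : \bar R :=
  (total_variation 0%R 1%R u
   + lambda%:E * (Lnorm01 p (u \- g)%R `^ gamma))%E.

Definition minimizer (T : Type) (R : realType) (A : set T) (F : T -> \bar R)
    (x : T) : Prop :=
  A x /\ forall y, A y -> (F x <= F y)%E.

(* Main.v *)
Require Import Defs.
From HB Require Import structures.
From mathcomp Require Import all_boot all_order all_algebra.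
From mathcomp Require Import all_classical all_reals all_analysis.
From mathcomp Require Import measurable_realfun ess_sup_inf lra.

Set Implicit Arguments.
Unset Strict Implicit.
Unset Printing Implicit Defensive.

Import Order.TTheory GRing.Theory Num.Theory.
Import numFieldNormedType.Exports.

Local Open Scope classical_set_scope.
Local Open Scope ring_scope.

(** Truncate the staircase from below: [u := max(chi, 2^-n)] differs from [chi]
    only on [[0, 3^-n]], by at most [2^-n]. The total variation drops by exactly
    [2^-n], while the fidelity term is at most [lambda * q ^ n] with
    [q = (2^-1 * 3^-(1/p)) `^ gamma]. The hypothesis on [gamma] says exactly that
    [q < 2^-1], so the gain in variation wins for large [n]. *)

Lemma staircase_itv (R : realType) (n : nat) (x : R) :
  0 <= x <= 1 -> 0 <= staircase n x <= 1.
Proof.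
elim: n x => //= n IHn x /andP[x0 x1].
have [x13|x13] := leP x (1 / 3).
  have /IHn/andP[? ?] : 0 <= 3 * x <= 1 by lra.
  by lra.
have [x23|x23] := ltP x (2 / 3); first lra.
have /IHn/andP[? ?] : 0 <= 3 * x - 2 <= 1 by lra.
by lra.
Qed.

Lemma staircase_nondecreasing (R : realType) (n : nat) (x y : R) :
  0 <= x -> x <= y -> y <= 1 -> staircase n x <= staircase n y.
Proof.
elim: n x y => //= n IHn x y x0 xy y1.
have [x13|x13] := leP x (1 / 3); have [y13|y13] := leP y (1 / 3).
- by rewrite ler_pM2r ?invr_gt0// IHn//; lra.
(* Points in different branches are compared through the plateau height [1 / 2]: the left copy stays
   below it and the right copy above. *)
- have /(staircase_itv n)/andP[_ sx] : 0 <= 3 * x <= 1 by lra.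
  have [y23|y23] := ltP y (2 / 3); first lra.
  have /(staircase_itv n)/andP[sy _] : 0 <= 3 * y - 2 <= 1 by lra.
  by lra.
- lra.
- have [x23|x23] := ltP x (2 / 3); have [y23|y23] := ltP y (2 / 3); try lra.
    have /(staircase_itv n)/andP[sy _] : 0 <= 3 * y - 2 <= 1 by lra.
    by lra.
  by rewrite ler_pM2r ?invr_gt0// lerD2l IHn//; lra.
Qed.

(** Branch choice depends on [x] alone, so both indices unfold in parallel, and each of the [N]
    unfoldings halves the gap or makes it zero. What remains is a gap between two values in
    [[0, 1]]. *)
Lemma staircase_dist (R : realType) (N m n : nat) (x : R) : 0 <= x <= 1 ->
  (N <= m)%N -> (N <= n)%N -> `|staircase m x - staircase n x| <= 2^-1 ^+ N.
Proof.
elim: N m n x => [|N IHN] m n x x01.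
  have /andP[? ?] := staircase_itv m x01; have /andP[? ?] := staircase_itv n x01.
  by move=> _ _; rewrite expr0 ler_norml; lra.
case: m => // m; case: n => // n; rewrite !ltnS exprS /= => Nm Nn.
have [x13|x13] := leP x (1 / 3).
  have x301 : 0 <= 3 * x <= 1 by lra.
  by have := IHN _ _ _ x301 Nm Nn; rewrite !ler_norml; lra.
have [x23|x23] := ltP x (2 / 3).
  by rewrite subrr normr0 mulr_ge0 ?exprn_ge0.
have x301 : 0 <= 3 * x - 2 <= 1 by lra.
by have := IHN _ _ _ x301 Nm Nn; rewrite !ler_norml; lra.
Qed.

Lemma is_cvg_staircase (R : realType) (x : R) : 0 <= x <= 1 ->
  cvgn (fun n => staircase n x).
Proof.
move=> x01; apply/cauchy_cvgP/cauchy_exP => e e0.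
have /cvgr0_norm_lt/(_ e e0)[N _ Ne] : (2^-1 : R) ^+ n @[n --> \oo] --> 0.
  by apply: cvg_expr; rewrite ger0_norm ?invr_ge0//; lra.
exists (staircase N x); exists N => // n /= Nn; rewrite /ball /=.
apply: le_lt_trans (staircase_dist x01 (leqnn N) Nn) _.
by have := Ne N (leqnn N); rewrite ger0_norm ?exprn_ge0.
Qed.

Lemma cantor_function_nondecreasing (R : realType) (x y : R) :
  0 <= x -> x <= y -> y <= 1 -> cantor_function x <= cantor_function y.
Proof.
move=> x0 xy y1; apply: ler_lim.
- by apply: is_cvg_staircase; lra.
- by apply: is_cvg_staircase; lra.
- by apply: nearW => n; exact: staircase_nondecreasing.
Qed.

Lemma cantor_function0 (R : realType) : @cantor_function R 0 = 0.
Proof.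
apply/cvg_lim => //; rewrite [X in X @ _ --> _](_ : _ = cst 0).
  exact: cvg_cst.
by apply/funext; elim=> //= n IHn; rewrite mulr0 IHn mul0r; case: ifPn => //; lra.
Qed.

(** The first [n] unfoldings take the left branch, each tripling the point and halving the value.
    They end at [1], which every [staircase k] fixes. Hence the sequence at this point is constant
    from index [n] on. *)
Lemma staircase_pow (R : realType) (n k : nat) :
  staircase (k + n) (3^-1 ^+ n : R) = 2^-1 ^+ n.
Proof.
elim: n => [|n IHn].
  rewrite addn0 !expr0; elim: k => //= k IHk.
  case: ifPn; first lra.
  move=> _; case: ifPn; first lra.
  by move=> _; have -> : 3 * 1 - 2 = 1 :> R; lra.
have pow3S : 3 * 3^-1 ^+ n.+1 = 3^-1 ^+ n :> R.
  by rewrite exprS mulrA divff ?mul1r ?pnatr_eq0.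
have pow3S_le : 3^-1 ^+ n.+1 <= 1 / 3 :> R.
  by rewrite ler_pdivlMr// mulrC pow3S; apply: exprn_ile1; lra.
by rewrite addnS /= pow3S_le pow3S IHn exprSr.
Qed.

Lemma cantor_function_pow (R : realType) (n : nat) :
  cantor_function (3^-1 ^+ n : R) = 2^-1 ^+ n.
Proof.
apply/cvg_lim => //; rewrite -(cvg_shiftn n).
rewrite [X in X @ _ --> _](_ : _ = cst (2^-1 ^+ n)); first exact: cvg_cst.
by apply/funext => k /=; exact: staircase_pow.
Qed.

Lemma cantor_function1 (R : realType) : @cantor_function R 1 = 1.
Proof. exact: (cantor_function_pow R 0). Qed.

(* [ge0_le_integral] without the measurability hypotheses: the integral of a
   nonnegative function is a supremum over the simple functions below it. *)
Lemma ge0_le_integral_setT d (T : measurableType d) (R : realType)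
    (mu : {measure set T -> \bar R}) (f g : T -> \bar R) :
  (forall x, 0 <= f x)%E -> (forall x, f x <= g x)%E ->
  (\int[mu]_x f x <= \int[mu]_x g x)%E.
Proof.
move=> f0 fg; have g0 x : (0 <= g x)%E by exact: le_trans (f0 x) (fg x).
rewrite !ge0_integralTE//; apply: ereal_sup_le => _ [h hf <-].
by exists h => // x; exact: le_trans (hf x) (fg x).
Qed.

(** For finite [p] this integrates the pointwise bound on the [p]-th power. For [p = +oo] the
    exponent [fine p^-1] is [0], so the right-hand side is just [c], which bounds the essential
    supremum. *)
Lemma Lnorm_le_cst_indic d (T : measurableType d) (R : realType)
    (mu : {measure set T -> \bar R}) (p : \bar R) (f : T -> \bar R)
    (A : set T) (c : R) :
  (0 < p)%E -> measurable A -> 0 <= c ->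
  (forall x, `|f x| <= (c * \1_A x)%:E)%E ->
  (Lnorm mu p f <= c%:E * mu A `^ (fine p^-1))%E.
Proof.
move=> p0 mA c0 fA; rewrite unlock; case: p p0 => [r| |//] p0 /=.
  rewrite lte_fin in p0.
  have -> : fine (r%:E^-1)%E = r^-1 by rewrite inver gt_eqF.
  (* With [c] written this way both sides are [r^-1]-th powers, so it suffices to compare the
     bases. *)
  have -> : (c%:E = (c `^ r)%:E `^ r^-1)%E.
    by rewrite poweR_EFin -powRrM mulfV ?gt_eqF// powRr1.
  rewrite -poweRM ?lee_fin ?powR_ge0//.
  apply: gt0_ler_poweR; rewrite ?invr_ge0 ?(ltW p0)//.
  - by rewrite in_itv/= leey andbT; apply: integral_ge0 => x _; exact: poweR_ge0.
  - by rewrite in_itv/= leey andbT mule_ge0// lee_fin powR_ge0.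
  have -> : ((c `^ r)%:E * mu A = \int[mu]_x ((c `^ r)%:E * (\1_A x)%:E))%E.
    rewrite ge0_integralZl_EFin ?powR_ge0 ?integral_indic ?setIT//.
    exact/measurable_EFinP.
  apply: ge0_le_integral_setT => x; first exact: poweR_ge0.
  apply: le_trans (_ : (((c * \1_A x)%:E) `^ r <= _)%E).
    apply: gt0_ler_poweR; rewrite ?(ltW p0) ?in_itv/= ?leey ?andbT//.
    by rewrite lee_fin mulr_ge0.
  rewrite poweR_EFin powRM// EFinM indicE.
  by case: (x \in A); rewrite ?powR1// powR0 ?gt_eqF.
rewrite poweRe0 mule1; case: ifPn => // _.
apply/ess_supP; apply: nearW => x /=; apply: le_trans (fA x) _.
by rewrite lee_fin ler_piMr// indicE; case: (_ \in _).
Qed.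

(** Since [a / b < 1], the powers of [a / b] eventually drop below [lambda^-1]. *)
Lemma exists_pow_gt (R : realType) (lambda a b : R) :
  0 < lambda -> 0 <= a -> a < b -> exists n, lambda * a ^+ n < b ^+ n.
Proof.
move=> l0 a0 ab; have b0 : 0 < b by exact: le_lt_trans ab.
have : (a / b) ^+ n @[n --> \oo] --> 0.
  by apply: cvg_expr; rewrite ger0_norm ?divr_ge0 ?(ltW b0)// ltr_pdivrMr ?mul1r.
move/cvgr0_norm_lt => /(_ lambda^-1); rewrite invr_gt0 => /(_ l0)[N _ /(_ N)].
move=> /(_ (leqnn N)); rewrite ger0_norm ?exprn_ge0 ?divr_ge0 ?(ltW b0)//.
rewrite expr_div_n ltr_pdivrMr ?exprn_gt0// ltr_pdivlMl// => ?.
by exists N.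
Qed.

Theorem theorem3p1 (R : realType) (lambda gamma : R) (p : \bar R)
    (lambda_gt0 : 0 < lambda) (gamma_gt0 : 0 < gamma) (p_ge1 : (1 <= p)%E)
    (gamma_gt : gamma > (fine (p^-1)%E * (ln 3 / ln 2) + 1)^-1) :
  ~ minimizer [set u : R -> R | bounded_variation 0 1 u]
      (TVfidelity lambda gamma p (@cantor_function R)) (@cantor_function R).
Proof.
case=> _ chi_min.
have p_gt0 : (0 < p)%E by exact: lt_le_trans p_ge1.
set t := fine p^-1%E in gamma_gt.
have t0 : 0 <= t by rewrite fine_ge0// inve_ge0 ltW.
have ln2 : 0 < ln 2 :> R by rewrite ln_gt0// ltr1n.
have ln3 : 0 < ln 3 :> R by rewrite ln_gt0// ltr1n.
(* After taking logarithms this reads [gamma * (ln 2 + t * ln 3) > ln 2], which is [gamma_gt] with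
   the inverse cleared and both sides multiplied by [ln 2]. *)
have q_lt : (2^-1 * 3^-1 `^ t) `^ gamma < 2^-1.
  rewrite -ltr_ln ?posrE ?powR_gt0 ?mulr_gt0 ?powR_gt0 ?invr_gt0//.
  rewrite ln_powR lnM ?posrE ?powR_gt0 ?invr_gt0// ln_powR !lnV ?posrE//.
  have D0 : 0 < t * (ln 3 / ln 2) + 1.
    by rewrite ltr_wpDl// mulr_ge0// divr_ge0// ltW.
  move: gamma_gt; rewrite -(ltr_pM2r D0) mulVf ?gt_eqF// -(ltr_pM2r ln2) mul1r.
  rewrite -mulrA mulrDl -mulrA divfK ?gt_eqF//; lra.
have [n n_gt] := exists_pow_gt lambda_gt0 (powR_ge0 _ _) q_lt.
set c : R := 2^-1 ^+ n in n_gt.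
have c0 : 0 < c by rewrite exprn_gt0 ?invr_gt0.
have c1 : c <= 1 by apply: exprn_ile1; lra.
set w : R := 3^-1 ^+ n.
have w0 : 0 < w by rewrite exprn_gt0 ?invr_gt0.
pose chi := @cantor_function R.
pose u x := Num.max (chi x) c.
have chi_w : chi w = c by exact: cantor_function_pow.
have u_homo : {in `[0, 1] &, {homo u : x y / x <= y}}.
  move=> x y; rewrite !in_itv/= => /andP[x0 _] /andP[_ y1] xy.
  by rewrite /u le_max2// cantor_function_nondecreasing.
have TVu : total_variation 0 1 u = (1 - c)%:E.
  rewrite nondecreasing_total_variation// /u /chi cantor_function0.
  by rewrite cantor_function1 (max_l c1) (max_r (ltW c0)).
have u_chi : (Lnorm01 p (u \- chi)%R <= (c * w `^ t)%:E)%E.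
  have <- : (c%:E * lebesgue_measure `[0%R, w]%classic `^ t
             = (c * w `^ t)%:E)%E.
    by rewrite lebesgue_measure_itv/= lte_fin w0 oppr0 adde0 poweR_EFin EFinM.
  apply: Lnorm_le_cst_indic => //; first exact: ltW.
  move=> x; rewrite patchE; case: ifPn; last first.
    by rewrite abse0 lee_fin mulr_ge0// ltW.
  rewrite inE /= in_itv/= => /andP[x0 x1]; rewrite lee_fin indicE /u.
  (* Up to [w], [chi x >= 0] keeps the gap [u x - chi x] within [[0, c]]; beyond [w], monotonicity
     gives [chi x >= chi w = c], so [u x = chi x]. *)
  have [xn|xn] := leP x w.
    have -> : (x \in `[0, w]%classic) = true.
      by apply: mem_set; rewrite /= in_itv/= x0.
    rewrite mulr1.
    have : 0 <= chi x by rewrite -cantor_function0 cantor_function_nondecreasing.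
    by move=> chi0; rewrite ler_norml; case: (leP (chi x) c); lra.
  rewrite max_l ?subrr ?normr0 ?mulr_ge0 ?(ltW c0)//.
  by rewrite -chi_w cantor_function_nondecreasing// ltW.
have fidelity_eq : (c * w `^ t) `^ gamma
    = ((2^-1 * 3^-1 `^ t) `^ gamma) ^+ n.
  rewrite -[RHS]powR_mulrn ?powR_ge0// powRAC powR_mulrn ?mulr_ge0 ?powR_ge0//.
  have -> : w = 3^-1 `^ n%:R by rewrite powR_mulrn.
  by rewrite exprMn powRAC powR_mulrn ?powR_ge0.
have bv_u : bounded_variation 0 1 u by apply/bounded_variationP; rewrite ?TVu.
have := chi_min u bv_u; apply/negP; rewrite -ltNge.
(* The value [1] separates the two energies: that of [u] is at most [1 - c + lambda * q ^ n < 1],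
   while that of [chi] is at least its variation, hence at least [chi 1 - chi 0 = 1]. *)
apply: (@lt_le_trans _ _ 1%E).
  apply: (@le_lt_trans _ _ ((1 - c)%:E
      + lambda%:E * (c * w `^ t)%:E `^ gamma)%E).
    rewrite /TVfidelity TVu leeD2l// lee_wpmul2l ?lee_fin ?(ltW lambda_gt0)//.
    apply: gt0_ler_poweR; rewrite ?(ltW gamma_gt0) ?in_itv/= ?leey ?andbT//.
      exact: Lnorm_ge0.
    by rewrite lee_fin mulr_ge0 ?powR_ge0// ltW.
  rewrite poweR_EFin fidelity_eq -EFinM -EFinD lte_fin; lra.
rewrite -[leLHS]adde0; apply: leeD.
  apply: le_trans (total_variation_ge _ ler01).
  by rewrite cantor_function1 cantor_function0 subr0 normr1.
by rewrite mule_ge0 ?poweR_ge0// lee_fin ltW.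
Qed.
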